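(* Let $k$ and $n$ be positive integers and let $Q_n$ be the $n$-dimensional hypercube graph. Then $b_k(Q_n) \geq n - \lceil \log_2 k \rceil$.
   Context: All graphs are finite, simple and undirected. The hypercube $Q_n$ has vertex set the power set of $[n]=\{1,\dots,n\}$, with $u,v$ adjacent iff $|u\Delta v|=1$. $k$-liminal burning game on $G$ ($k$ a positive integer): two players, Saboteur and Arsonist. Each vertex is burned or unburned, and revealed or unrevealed; initially all are unburned and unrevealed. In each round: (i) propagation: every unburned vertex with a neighbor burned in an earlier round becomes burned (whether revealed or not); (ii) the Saboteur reveals $k$ vertices that are unrevealed and unburned (all such vertices if fewer than $k$ exist); revealed vertices stay revealed; (iii) the Arsonist burns one revealed unburned vertex (revealed in this or any earlier round), if one exists. The game ends in the round in which all vertices are burned. The Saboteur maximizes and the Arsonist minimizes the number of rounds; $b_k(G)$ is the number of rounds under optimal play. *)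

(* Defs.v *)
From mathcomp Require Import all_boot.

Set Implicit Arguments.
Unset Strict Implicit.
Unset Printing Implicit Defensive.

Record sgraph := SGraph {
  vertex :> finType;
  adj : rel vertex;
  adj_sym : symmetric adj;
  adj_irr : irreflexive adj
}.
Arguments adj {s}.

Definition symdiff (T : finType) (u v : {set T}) : {set T} :=
  (u :\: v) :|: (v :\: u).

Definition hypercube_adj (n : nat) : rel {set 'I_n} :=
  fun u v => #|symdiff u v| == 1.

Lemma hypercube_adj_sym (n : nat) : symmetric (@hypercube_adj n).
Proof. by move=> u v; rewrite /hypercube_adj /symdiff setUC. Qed.

Lemma hypercube_adj_irr (n : nat) : irreflexive (@hypercube_adj n).
Proof. by move=> u; rewrite /hypercube_adj /symdiff setDv setU0 cards0. Qed.

(* The ground set [n] is encoded as 'I_n = {0, ..., n - 1}. *)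
Definition hypercube (n : nat) : sgraph :=
  SGraph (@hypercube_adj_sym n) (@hypercube_adj_irr n).

(* The minimum of f over A, or d when A is empty. *)
Definition min_over (T : finType) (A : {set T}) (f : T -> nat) (d : nat) : nat :=
  if [pick x in A] is Some x0 then f [arg min_(x < x0 in A) f x] else d.

Definition propagate (G : sgraph) (B : {set G}) : {set G} :=
  B :|: [set v | [exists u in B, adj u v]].

(* B is the burned set after propagation, and R the previously revealed set. *)
Definition legal_reveal (k : nat) (G : sgraph) (B R S : {set G}) : bool :=
  (S \subset ~: (B :|: R)) && (#|S| == minn k #|~: (B :|: R)|).

(* Minimax number of further rounds from the end of a round, with B burned and
   R revealed, in the game cut off after m rounds.  For k > 0 the cutoff is
   immaterial once m is at least the number of unburned vertices, by
   truncated_value_stable; the untruncated recursion is liminal_valueE. *)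
Fixpoint truncated_value (k : nat) (G : sgraph) (m : nat) (B R : {set G}) : nat :=
  if B == [set: G] then 0 else
  if m isn't m'.+1 then 0 else
  let B' := propagate B in
  (\max_(S : {set G} | legal_reveal k B' R S)
     min_over ((R :|: S) :\: B')
       (fun v => truncated_value k m' (v |: B') (R :|: S))
       (truncated_value k m' B' (R :|: S))).+1.

Definition liminal_value (k : nat) (G : sgraph) (B R : {set G}) : nat :=
  truncated_value k #|G| B R.

Definition liminal_burning_number (k : nat) (G : sgraph) : nat :=
  liminal_value k (set0 : {set G}) set0.

Lemma eq_min_over (T : finType) (A : {set T}) (f g : T -> nat) (d e : nat) :
    {in A, f =1 g} -> (A = set0 -> d = e) ->
  min_over A f d = min_over A g e.
Proof.
move=> fg de; rewrite /min_over; case: pickP => [x0 x0A | A0]; last first.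
  by apply: de; apply/setP => x; rewrite inE A0.
case: arg_minnP => // i iA ilt; case: arg_minnP => // j jA jlt.
have := ilt j jA; have := jlt i iA; rewrite -!fg // => ji ij.
by apply/eqP; rewrite eqn_leq ij ji.
Qed.

(* A round that does not end the game by propagation always offers the Arsonist
   a vertex to burn. *)
Lemma burnable_eq0 (k : nat) (G : sgraph) (B R S : {set G}) :
  0 < k -> legal_reveal k B R S -> (R :|: S) :\: B = set0 -> B = [set: G].
Proof.
move=> k0 /andP[sS /eqP cS] U0.
have S0 : S = set0.
  apply/setP => x; rewrite inE; apply/negbTE/negP => xS.
  move/subsetP/(_ x xS): (sS); rewrite !inE negb_or => /andP[xB _].
  by move/setP/(_ x): U0; rewrite !inE xB xS orbT.
have BR : B :|: R = [set: G].
  apply/eqP; rewrite -subTset -setCS setCT subset0 -cards_eq0.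
  move: cS; rewrite S0 cards0 => /esym/eqP.
  by rewrite /minn; case: ifP => // _; rewrite (gtn_eqF k0).
apply/setP => x; move/setP/(_ x): BR; rewrite !inE.
by move/setP/(_ x): U0; rewrite !inE; case: (x \in B); case: (x \in R).
Qed.

Lemma truncated_valueT (k : nat) (G : sgraph) (m : nat) (R : {set G}) :
  truncated_value k m [set: G] R = 0.
Proof. by case: m => [|m] /=; rewrite eqxx. Qed.

Lemma truncated_valueS (k : nat) (G : sgraph) (m : nat) (B R : {set G}) :
    0 < k -> #|~: B| <= m ->
  truncated_value k m.+1 B R = truncated_value k m B R.
Proof.
move=> k0; elim: m B R => [|m IH] B R Bm.
  suff -> : B = [set: G] by rewrite !truncated_valueT.
  by apply: setC_inj; rewrite setCT; apply/eqP; rewrite -cards_eq0 -leqn0.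
have [->|BT] := eqVneq B [set: G]; first by rewrite !truncated_valueT.
rewrite [LHS]/= [RHS]/= (negbTE BT); congr _.+1; apply: eq_bigr => S legS.
apply: eq_min_over => [v vU | U0].
  apply: IH; rewrite -ltnS; apply: leq_trans Bm; apply: proper_card.
  rewrite properE setCS.
  have sB : B \subset propagate B by apply: subsetUl.
  rewrite (subset_trans sB (subsetUr _ _)) /=.
  apply/subsetPn; exists v; last by rewrite !inE eqxx.
  move: vU; rewrite inE => /andP[vB _]; rewrite inE.
  by apply: contra vB; apply/subsetP.
by rewrite (burnable_eq0 k0 legS U0) eqxx truncated_valueT.
Qed.

Lemma truncated_value_stable (k : nat) (G : sgraph) (m : nat) (B R : {set G}) :
    0 < k -> #|~: B| <= m ->
  truncated_value k m B R = liminal_value k B R.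
Proof.
move=> k0; have main p : #|~: B| <= p ->
    truncated_value k p B R = truncated_value k #|~: B| B R.
  elim: p => [|p IH]; first by rewrite leqn0 => /eqP->.
  rewrite leq_eqVlt => /predU1P[<- //|]; rewrite ltnS => lep.
  by rewrite truncated_valueS ?IH.
by move=> Bm; rewrite /liminal_value !main ?max_card.
Qed.

Lemma liminal_valueE (k : nat) (G : sgraph) (B R : {set G}) :
    0 < k ->
  liminal_value k B R =
    if B == [set: G] then 0 else
    let B' := propagate B in
    (\max_(S : {set G} | legal_reveal k B' R S)
       min_over ((R :|: S) :\: B')
         (fun v => liminal_value k (v |: B') (R :|: S))
         (liminal_value k B' (R :|: S))).+1.
Proof.
move=> k0; rewrite -(@truncated_value_stable _ _ #|G|.+1) //.
exact: leqW (max_card _).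
Qed.

(* Main.v *)
(* Let d = up_log 2 k and N = n - d.  There is an antichain c_2, ..., c_(N-1) of
   subsets of [N] with #|c_i| = i.  If the Arsonist burns the empty set in round 1
   and c_t in each later round t, then after round t the vertices burned in Q_N
   have size less than t, or have size t and contain some c_i; as no other c_i is
   contained in c_(t+1), that vertex is still unburned in round t + 1, and [N]
   survives round N - 1.  In Q_n the Saboteur reveals in round t any k of the 2^d
   vertices whose trace on [N] is c_t: the traces burn as in Q_N, whichever vertex
   the Arsonist picks. *)
Require Import Defs.
From mathcomp Require Import all_boot.
From mathcomp Require Import zify.

Set Implicit Arguments.
Unset Strict Implicit.
Unset Printing Implicit Defensive.

Lemma leq_min_over (T : finType) (A : {set T}) (f : T -> nat) (d m : nat) :
  {in A, forall x, m <= f x} -> m <= d -> m <= min_over A f d.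
Proof.
move=> mf md; rewrite /min_over; case: pickP => [x0 x0A | _ //].
by case: arg_minnP => // i iA _; apply: mf.
Qed.

Lemma exists_subset_card (T : finType) (A : {set T}) (k : nat) :
  k <= #|A| -> exists2 S : {set T}, S \subset A & #|S| = k.
Proof.
move=> kA; exists [set:: take k (enum A)].
  by apply/subsetP => x; rewrite inE => /mem_take; rewrite mem_enum.
by rewrite cardsE (card_uniqP _) ?take_uniq ?enum_uniq // size_takel -?cardE.
Qed.

Lemma propagateP (G : sgraph) (B : {set G}) (v : G) :
  reflect (v \in B \/ exists2 u, u \in B & adj u v) (v \in propagate B).
Proof.
rewrite !inE; apply: (iffP orP) => -[vB|]; try by left.
  by move/exists_inP=> ?; right.
by move=> ?; right; apply/exists_inP.
Qed.

Lemma propagate_subset (G : sgraph) (A B : {set G}) :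
  A \subset B -> propagate A \subset propagate B.
Proof.
move=> /subsetP sAB; apply/subsetP => v /propagateP[/sAB vB | [u /sAB uB uv]].
  by apply/propagateP; left.
by apply/propagateP; right; exists u.
Qed.

(* [Z t] bounds both what can be burned and what is revealed after round [t]. *)
Lemma liminal_burning_number_gt (k T : nat) (G : sgraph) (Z : nat -> {set G}) :
    0 < k -> Z 0 = set0 -> Z T != setT ->
    (forall t, t < T -> propagate (Z t) \subset Z t.+1) ->
    (forall t, t < T -> k <= #|Z t.+1 :\: propagate (Z t)|) ->
  T < liminal_burning_number k G.
Proof.
move=> k0 Z0 ZT Zprop Zcard.
(* Induction on the number [s] of rounds still to survive, with [t] rounds already played. *)
suff main s t (B R : {set G}) : s + t = T -> B \subset Z t -> R \subset Z t ->
    s < liminal_value k B R.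
  by apply: (main T 0); rewrite ?addn0 ?sub0set.
elim: s t B R => [|s IH] t B R stT sB sR; rewrite liminal_valueE //.
  have /negbTE-> // : B != setT.
  by apply: contra ZT => /eqP BT; rewrite -stT -subTset -BT.
have tT : t < T by rewrite -stT addSn ltnS leq_addl.
have BP : B \subset propagate (Z t) by apply: (subset_trans sB); apply: subsetUl.
(* The Saboteur's move: [k] vertices of [Z t.+1] outside [propagate (Z t)]. That set contains both
   [propagate B] and [R], so the move is legal. *)
have [S sS cS] := exists_subset_card (Zcard t tT).
have sSP : S \subset ~: propagate (Z t).
  by apply: (subset_trans sS); apply: subsetDr.
have B'P := propagate_subset sB.
have RP : R \subset propagate (Z t) by apply: (subset_trans sR); apply: subsetUl.
have sSBR : S \subset ~: (propagate B :|: R).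
  by apply: (subset_trans sSP); rewrite setCS subUset B'P RP.
have BT : B != setT.
  apply: contraTneq k0 => BT; rewrite -leqNgt.
  move: (Zcard t tT) BP; rewrite BT subTset => kc /eqP PT.
  by move: kc; rewrite PT setDT cards0.
rewrite (negbTE BT) ltnS.
have legS : legal_reveal k (propagate B) R S.
  rewrite /legal_reveal sSBR /= cS; apply/eqP/esym/minn_idPl.
  by rewrite -cS; apply: subset_leq_card.
apply: leq_trans (leq_bigmax_cond _ legS).
have PZ := Zprop t tT.
have sRS : R :|: S \subset Z t.+1.
  by rewrite subUset (subset_trans RP PZ) (subset_trans sS) ?subsetDl.
have B'Z := subset_trans B'P PZ.
have st : s + t.+1 = T by rewrite addnS -addSn.
(* The default of the minimum, where no vertex is burned, falls under the same invariant. *)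
apply: leq_min_over => [v|]; last exact: IH st _ _.
rewrite inE => /andP[_ vRS]; apply: IH st _ _ => //.
by rewrite subUset sub1set B'Z andbT (subsetP sRS).
Qed.

(** Induction from [N] to [N.+2] adds two points [ord0] and [o1]. The pair of new points has size 2,
    the complement of [ord0] has size [N.+1], and the sizes between come from the old family shifted
    past both points, with [ord0] added. The pair is the only member containing both new points, and
    the complement of [ord0] is the only one without [ord0]. *)
Lemma antichain_each_card (N : nat) :
  exists c : nat -> {set 'I_N},
    (forall i, 1 < i < N -> #|c i| = i) /\
    (forall i j, 1 < i -> i < j < N -> ~~ (c i \subset c j)).
Proof.
elim/ltn_ind: N => -[|[|N]] IH.
- by exists (fun=> set0); split=> [i|i j]; lia.
- by exists (fun=> set0); split=> [i|i j]; lia.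
have [|c [cC cA]] := IH N; first by rewrite leqW.
pose o1 : 'I_N.+2 := lift ord0 ord0.
pose f (x : 'I_N) : 'I_N.+2 := lift ord0 (lift ord0 x).
have finj : injective f by move=> x y /lift_inj/lift_inj.
have f0 A : ord0 \notin f @: A.
  by apply/imsetP => -[x _ /eqP]; rewrite (negbTE (neq_lift _ _)).
have f1 A : o1 \notin f @: A.
  by apply/imsetP => -[x _ /lift_inj/eqP]; rewrite (negbTE (neq_lift _ _)).
have o01 : ord0 != o1 := neq_lift _ _.
exists (fun i => if i == 2 then [set ord0; o1]
                 else if i == N.+1 then [set~ ord0]
                 else ord0 |: f @: c i.-1); split=> [i|i j].
  case: eqP => [-> _|i2]; first by rewrite cards2 o01.
  case: eqP => [-> _|iN]; first by rewrite cardsC1 card_ord.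
  move=> /andP[i1 iN2]; rewrite cardsU1 f0 card_imset // cC.
    by rewrite add1n prednK // ltnW.
  by lia.
move=> i1 /andP[ij jN].
have j2 : j != 2 by rewrite neq_ltn (leq_ltn_trans i1 ij) orbT.
have iN : i != N.+1 by rewrite neq_ltn -ltnS (leq_trans _ jN).
rewrite (negbTE j2) (negbTE iN).
have [_|jN1] := eqVneq j N.+1.
  apply/subsetPn; exists ord0; last by rewrite !inE eqxx.
  by case: ifP; rewrite !inE.
have [_|i2] := eqVneq i 2.
  apply/subsetPn; exists o1; first by rewrite !inE eqxx orbT.
  by rewrite !inE negb_or f1 andbT eq_sym.
have /subsetPn[x xi xj] : ~~ (c i.-1 \subset c j.-1) by apply: cA; lia.
apply/subsetPn; exists (f x); first by rewrite setU1r // imset_f.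
by rewrite in_setU1 negb_or eq_sym neq_lift /= mem_imset.
Qed.

Lemma hypercube_adj_card (n : nat) (u v : hypercube n) :
  adj u v -> #|v| <= #|u|.+1 /\ (#|v| = #|u|.+1 -> u \subset v).
Proof.
rewrite /adj /= /hypercube_adj /symdiff => /eqP.
rewrite cardsU (_ : (u :\: v) :&: (v :\: u) = set0) ?cards0 ?subn0; last first.
  by apply/setP => x; rewrite !inE; case: (x \in u); case: (x \in v).
(* Inclusion becomes [#|u :\: v| = 0], which leaves arithmetic on three cardinals. *)
rewrite -(cardsID v u) -[#|v|](cardsID u) (setIC v u) -setD_eq0 -cards_eq0.
by move: #|_ :\: _| #|_ :\: _| #|_ :&: _| => a b c; lia.
Qed.

(** An edge flips one coordinate: if it lies outside the image of [f] the traces agree, otherwise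
    they differ in one point. *)
Lemma preimset_hypercube_adj (N n : nat) (f : 'I_N -> 'I_n) (u v : hypercube n) :
    injective f -> adj u v ->
  f @^-1: u = f @^-1: v \/ @adj (hypercube N) (f @^-1: u) (f @^-1: v).
Proof.
move=> finj; rewrite /adj /= /hypercube_adj => /eqP uv.
have symE : symdiff (f @^-1: u) (f @^-1: v) = f @^-1: symdiff u v.
  by apply/setP => x; rewrite !inE.
have : #|symdiff (f @^-1: u) (f @^-1: v)| <= 1.
  rewrite symE -uv -(card_imset _ finj); apply: subset_leq_card.
  by apply/subsetP => _ /imsetP[x + ->]; rewrite inE.
rewrite leq_eqVlt ltnS leqn0 => /orP[->|]; first by right.
rewrite cards_eq0 setU_eq0 !setD_eq0 => uv0; left.
by apply/eqP; rewrite eqEsubset.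
Qed.

(** Fire spreads no faster on traces than in the smaller cube. *)
Lemma preimset_propagate (N n : nat) (f : 'I_N -> 'I_n)
    (Y : {set hypercube N}) :
    injective f ->
  @propagate (hypercube n) [set v : {set 'I_n} | f @^-1: v \in Y] \subset
    [set v : {set 'I_n} | f @^-1: v \in propagate Y].
Proof.
move=> finj; apply/subsetP => v vP; rewrite in_set.
case/propagateP: vP => [|[u]]; rewrite in_set => uY.
  by apply/propagateP; left.
case/(preimset_hypercube_adj finj) => [<-|uv]; apply/propagateP.
  by left.
by right; exists (f @^-1: u).
Qed.

(** The image of [c] may be joined with any subset of the [n - N] points that [f] misses. *)
Lemma card_preimset_fiber (N n : nat) (f : 'I_N -> 'I_n) (c : {set 'I_N}) :
  injective f -> 2 ^ (n - N) <= #|[set v : {set 'I_n} | f @^-1: v == c]|.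
Proof.
move=> finj; pose C := ~: (f @: [set: 'I_N]).
have -> : n - N = #|C|.
  have := cardsC (f @: [set: 'I_N]).
  by rewrite card_imset // cardsT !card_ord -/C; lia.
rewrite -card_powerset.
have fC X x : X \in powerset C -> (f x \in X) = false.
  by rewrite powersetE => /subsetP XC; apply/negP => /XC; rewrite inE imset_f.
have ginj : {in powerset C &, injective (fun X => f @: c :|: X)}.
  move=> X Y XC YC /setP XY.
  apply/setP => y; have := XY y; rewrite !in_setU.
  have [/imsetP[x _ ->] _|//] := boolP (y \in f @: c).
  by rewrite !fC.
rewrite -(card_in_imset ginj); apply: subset_leq_card.
apply/subsetP => _ /imsetP[X XC ->]; rewrite inE.
by apply/eqP/setP => x; rewrite !inE mem_imset // fC // orbF.
Qed.

Lemma hypercube_cooling_sets (N : nat) :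
  exists Y : nat -> {set hypercube N},
    [/\ Y 0 = set0, Y N.-1 != setT &
        forall t, t < N.-1 -> propagate (Y t) \subset Y t.+1 /\
          exists2 c, c \in Y t.+1 & c \notin propagate (Y t)].
Proof.
have [c [cC cA]] := antichain_each_card N.
(* The bound [1 < i] makes [Y 1] the singleton of the empty set. *)
pose Y t : {set hypercube N} := [set v : {set 'I_N} | (#|v| < t) ||
  (#|v| == t) && [exists i : 'I_N, (1 < i <= t) && (c i \subset v)]].
have Y0 : Y 0 = set0.
  apply/setP => v; rewrite !inE ltn0; apply/negbTE/negP => /andP[_].
  by move=> /existsP[i]; case: (i : nat) => [|[|?]].
case: N c cC cA @Y Y0 => [|N] c cC cA Y Y0.
  by exists (fun=> set0); split=> //; apply/eqP => /setP/(_ set0); rewrite !inE.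
exists Y; split=> // [|t tN].
  apply/eqP => /setP/(_ [set: 'I_N.+1]); rewrite !inE cardsT card_ord /=.
  by rewrite ltnNge leqW // gtn_eqF.
(* Size [t.+1] is reached only from some [u] in [Y t] of size [t] with [u \subset v], so [v]
   inherits a [c i] with [i <= t]. *)
have YP v : v \in propagate (Y t) -> (#|v| <= t) ||
    (#|v| == t.+1) && [exists i : 'I_N.+1, (1 < i <= t) && (c i \subset v)].
  case/propagateP=> [|[u]]; rewrite inE.
    by case/orP=> [/ltnW-> //|/andP[/eqP-> _]]; rewrite leqnn.
  case/orP=> [ut|/andP[/eqP ut /existsP[i /andP[it ciu]]]] /hypercube_adj_card[vu uv].
    by rewrite (leq_trans vu).
  move: vu uv; rewrite ut leq_eqVlt => /orP[/eqP vt /(_ vt) uv|vt _].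
    rewrite vt eqxx ltnn; apply/existsP; exists i.
    by rewrite it (subset_trans ciu).
  by rewrite -ltnS vt.
split.
  apply/subsetP => v /YP; rewrite inE ltnS.
  case/orP=> [->//|/andP[-> /existsP[i /andP[/andP[i1 it] civ]]]].
  by apply/orP; right; apply/existsP; exists i; rewrite i1 civ leqW.
case: (posnP t) => [t0|t_gt0].
  exists (set0 : {set 'I_N.+1}); first by rewrite inE cards0.
  by apply/propagateP; rewrite t0 Y0 => -[|[u]]; rewrite inE.
have ct : #|c t.+1| = t.+1 by apply: cC; rewrite !ltnS t_gt0.
exists (c t.+1).
  rewrite inE ct eqxx ltnn; apply/existsP.
  have tN1 : t.+1 < N.+1 by [].
  by exists (Ordinal tN1); rewrite /= ltnS t_gt0 leqnn subxx.
apply/negP => /YP; rewrite ct ltnn eqxx => /existsP[i /andP[/andP[i1 it] ci]].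
by move: ci; apply/negP/cA => //; rewrite !ltnS it.
Qed.

Theorem corollary4 (k n : nat) (hk : 0 < k) (hn : 0 < n) :
  n - up_log 2 k <= liminal_burning_number k (hypercube n).
Proof.
set N := n - up_log 2 k.
have [->//|N0] := posnP N.
have Nn : N <= n by apply: leq_subr.
have [Y [Y0 YT YS]] := hypercube_cooling_sets N.
have finj : injective (widen_ord Nn) by move=> i j [/val_inj].
pose Z t : {set hypercube n} := [set v : {set 'I_n} | widen_ord Nn @^-1: v \in Y t].
rewrite -(prednK N0); apply: (@liminal_burning_number_gt _ _ _ Z) => //.
- by apply/setP => v; rewrite inE Y0 !inE.
(* Every [y] is the trace of its own image, so if [Z] were full, [Y] would be full. *)
- apply: contra YT => /eqP/setP ZT; apply/eqP/setP => y.
  have := ZT (widen_ord Nn @: y); rewrite in_set !in_setT => <-.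
  suff -> : widen_ord Nn @^-1: (widen_ord Nn @: y) = y by [].
  by apply/setP => x; rewrite inE mem_imset.
- move=> t /YS[/subsetP PY _]; apply: (subset_trans (preimset_propagate (Y t) finj)).
  by apply/subsetP => v; rewrite in_set => /PY; rewrite in_set.
(* As [N] is positive, [n - N] is exactly [up_log 2 k]; the fiber over [c] thus has at least [k]
   vertices. *)
move=> t /YS[_ [c cY cP]]; have k2 : k <= 2 ^ (n - N).
  apply: leq_trans (up_logP k (isT : 1 < 2)) _.
  by rewrite leq_exp2l // subKn // ltnW // -subn_gt0.
apply: leq_trans k2 (leq_trans (card_preimset_fiber c finj) _).
apply: subset_leq_card; apply/subsetP => v; rewrite inE => /eqP vc.
rewrite in_setD [v \in Z _]inE vc cY andbT.
apply: contra cP => /(subsetP (preimset_propagate (Y t) finj)).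
by rewrite in_set vc.
Qed.
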